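(* Let $H$ be a hypergraph with average degree $\overline{d}$. Then $\rho(\mathcal{A}_H)\geqslant\overline{d}$, with equality if and only if $H$ is regular.
   Context: A (finite) hypergraph $H$ has vertex set $V(H)$ and edge set $E(H)$, a set of nonempty subsets of $V(H)$, with at least one edge (so that the rank is defined). The degree $d_i$ of a vertex $i$ is the number of edges containing $i$; the average degree is $\overline{d}=\frac{1}{|V(H)|}\sum_{i\in V(H)}d_i$; $H$ is regular if all vertices have the same degree. The rank $r(H)$ is the maximum cardinality of an edge. The adjacency tensor $\mathcal{A}_H=(a_{i_1\cdots i_k})$ of a hypergraph $H$ with $r(H)=k$ is the order $k$, dimension $|V(H)|$ symmetric tensor with $a_{i_1\cdots i_k}=\frac{1}{(k-1)!}$ if $\{i_1,\ldots,i_k\}$ is an edge of cardinality $k$; $a_{i_1\cdots i_k}=\frac{(k-s+1)!}{k!}$ if, as a multiset, $\{i_1,\ldots,i_k\}$ consists of $j_1$ with multiplicity $k-s+1$ and $j_2,\ldots,j_s$ each with multiplicity one, for some edge $\{j_1,\ldots,j_s\}\in E(H)$ of cardinality $s<k$ (any element of the edge may play the role of $j_1$); and $a_{i_1\cdots i_k}=0$ otherwise. For an order $m$ dimension $n$ tensor $\mathcal{A}=(a_{i_1\cdots i_m})$ and $x\in\mathbb{C}^n$, $\mathcal{A}x^{m-1}\in\mathbb{C}^n$ has $i$-th component $\sum_{i_2,\ldots,i_m=1}^n a_{ii_2\cdots i_m}x_{i_2}\cdots x_{i_m}$. A number $\lambda\in\mathbb{C}$ is an eigenvalue of $\mathcal{A}$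 if $\mathcal{A}x^{m-1}=\lambda x^{[m-1]}$ for some nonzero $x\in\mathbb{C}^n$, where $x^{[m-1]}=(x_1^{m-1},\ldots,x_n^{m-1})^{\mathrm T}$. The spectral radius is $\rho(\mathcal{A})=\max\{|\lambda|:\lambda \text{ an eigenvalue of }\mathcal{A}\}$. *)

(* Defs.v *)
From HB Require Import structures.
From mathcomp Require Import all_boot all_order all_algebra.
From mathcomp Require Import reals complex.

Set Implicit Arguments.
Unset Strict Implicit.
Unset Printing Implicit Defensive.

Import Order.TTheory GRing.Theory Num.Theory.
Local Open Scope ring_scope.
Local Open Scope complex_scope.

Record hypergraph (V : finType) := Hypergraph {
  edges : {set {set V}};
  edges_nonempty : set0 \notin edges;
  has_edge : edges != set0
}.

Section Hypergraph.
Variables (V : finType) (H : hypergraph V).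

Definition degree (i : V) : nat := #|[set e in edges H | i \in e]|.

Definition rank : nat := \max_(e in edges H) #|e|.

Definition regular : Prop := forall i j : V, degree i = degree j.

Definition avg_degree (R : realType) : R :=
  (\sum_(i : V) (degree i)%:R) / #|V|%:R.

Lemma rank_gt0 : (0 < rank)%N.
Proof.
have /set0Pn [e eH] := has_edge H.
apply: (@leq_trans #|e|); last by rewrite /rank (bigD1 e) //= leq_maxl.
rewrite card_gt0; apply: contraNneq (edges_nonempty H) => e0.
by rewrite -e0.
Qed.

End Hypergraph.

(* Complex tensors of order m whose indices range over V, so of dimension #|V|. *)
Definition tensor (R : realType) (m : nat) (V : finType) := m.-tuple V -> R[i].

Section Tensor.
Variables (R : realType) (V : finType) (m : nat) (A : tensor R m V).

(* The i-th component of A x^(m-1): the sum runs over all index tuples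
   (i_1, ..., i_m) with i_1 = i, and the product over i_2, ..., i_m.
   Only orders m > 0 are meaningful. *)
Definition tensor_apply (x : {ffun V -> R[i]}) (i : V) : R[i] :=
  \sum_(t : m.-tuple V | ohead t == Some i) A t * \prod_(j <- behead t) x j.

Definition is_eigenvalue (lambda : R[i]) : Prop :=
  exists2 x : {ffun V -> R[i]}, x != 0 &
    forall i : V, tensor_apply x i = lambda * x i ^+ m.-1.

(* rho is the maximum of the moduli of the eigenvalues of A; a relation, since
   the maximum may fail to exist (a tensor of order 1 with non-constant entries
   has no eigenvalue). *)
Definition is_spectral_radius (rho : R) : Prop :=
  (exists2 lambda, is_eigenvalue lambda & `|lambda| = rho%:C) /\
  (forall lambda, is_eigenvalue lambda -> `|lambda| <= rho%:C).

End Tensor.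

(* If the multiset {i_1, ..., i_k} is built from an edge, that edge is the set e
   of the indices occurring in t. *)
Definition adjacency_tensor (R : realType) (V : finType) (H : hypergraph V) :
    tensor R (rank H) V :=
  fun t =>
    let k := rank H in
    let e := [set j in t] in
    let s := #|e| in
    if e \notin edges H then 0
    else if s == k then ((k.-1)`!)%:R^-1
    else if [exists j1 in e, (count_mem j1 t == (k - s).+1) &&
                             [forall j in e :\ j1, count_mem j t == 1%N]]
    then ((k - s).+1)`!%:R / (k`!)%:R
    else 0.

Arguments adjacency_tensor R {V} H t.

(* Main.v *)
Require Import Defs.
From mathcomp Require Import all_boot all_order all_algebra.
From mathcomp Require Import reals complex.
From mathcomp Require Import ring.
From mathcomp Require Import boolp classical_sets topology.
From mathcomp Require Import normedtype derive realfun.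

(** The adjacency tensor is real, nonnegative and symmetric, and the argument is
the variational one.  For [z >= 0] put [F z = sum_t a_t prod_(j in t) z_j] and
[N z = sum_j z_j ^ k], where [k] is the rank, and let [M] be the maximum of the
Rayleigh quotient [F / N] over nonzero [z >= 0]; it exists because the quotient
is homogeneous of degree zero and continuous on the compact simplex
([rayleigh_maximum]).

For [k >= 2] this [M] is the spectral radius ([spectral_radius_rayleigh]).  On
the one hand every eigenvalue has modulus at most [M]: taking moduli in the
eigenvalue equation of [x], multiplying the [i]-th line by [|x_i|] and adding up
gives [|lambda| N |x| <= F |x| <= M N |x|].  On the other hand a maximizer [y]
is an eigenvector for [M] ([maximizer_is_eigenvector]): raising one coordinate
of [y] cannot improve the quotient, which gives [(A y^(k-1))_i <= M y_i^(k-1)]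
for each [i], and Euler's identity [F y = sum_i y_i (A y^(k-1))_i] forces
equality wherever [y_i > 0]; where [y_i = 0] both sides vanish.

The entries of the adjacency tensor are chosen so that its [i]-th row sum is the
degree of [i] ([row_sum_degree]).  Hence [F 1 / N 1] is the average degree, and
the inequality follows.  If it is an equality, then the all-ones vector is a
maximizer, hence an eigenvector, so all row sums are equal to [M] and the
hypergraph is regular.  If the hypergraph is regular of degree [d], then the
eigenvalue equation of [y] at its largest coordinate gives [M <= d]
([eigenvalue_le_row_sum]).

For [k = 1] the vector [A x^(k-1)] is the vector of degrees whatever [x] is, so
an eigenvalue exists only if all degrees agree, and it is their common value. *)

Set Implicit Arguments.
Unset Strict Implicit.
Unset Printing Implicit Defensive.

Import Order.TTheory GRing.Theory Num.Theory.
Import numFieldNormedType.Exports.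
Local Open Scope ring_scope.


(** * The form of a real tensor *)

Section TensorFormDefinitions.
Variables (R : realType) (V : finType) (m : nat) (a : m.-tuple V -> R).
Implicit Types y z : V -> R.

Definition tensor_form z := \sum_t a t * \prod_(j <- t) z j.

(** The [m]-th power of the [m]-norm when [z >= 0]; keeping the power avoids
[m]-th roots. *)
Definition power_mass (z : V -> R) := \sum_j z j ^+ m.

Lemma power_mass_gt0 z :
  (forall j, 0 <= z j) -> 0 < \sum_j z j -> 0 < power_mass z.
Proof.
move=> z0; rewrite !lt_neqAle ![0 == _]eq_sym !sumr_ge0 ?andbT //; last first.
  by move=> j _; rewrite exprn_ge0.
apply: contraNN => /eqP/psumr_eq0P zm0; apply/eqP; apply: big1 => j _.
have /eqP := zm0 (fun j _ => exprn_ge0 m (z0 j)) j isT.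
by rewrite expf_eq0 => /andP[_ /eqP].
Qed.

(** The real counterpart of [tensor_apply].  When [a] is symmetric, the gradient
of [tensor_form] is [m] times this vector. *)
Definition contract z i :=
  \sum_(t : m.-tuple V | ohead t == Some i) a t * \prod_(j <- behead t) z j.

End TensorFormDefinitions.

(** * A maximum of the Rayleigh quotient on the simplex *)

(** Continuity is stated for functions [x i] on an abstract space [T]; the use
below takes for them the coordinates on a product of copies of [R]. *)
Section PolynomialContinuity.
Variables (R : realType) (V : finType) (T : topologicalType) (x : V -> T -> R).
Hypothesis x_continuous : forall i, continuous (x i).

Lemma continuous_linear_form : continuous (fun p => \sum_i x i p).
Proof.
by apply: continuous_big => // q; exact: add_continuous.
Qed.

Lemma continuous_power_sum m : continuous (fun p => \sum_i x i p ^+ m).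
Proof.
apply: continuous_big => [q|i _ p]; first exact: add_continuous.
exact: (continuous_comp (@x_continuous i p) (@exprn_continuous _ m _)).
Qed.

Lemma continuous_tensor_form m (a : m.-tuple V -> R) :
  continuous (fun p => \sum_t a t * \prod_(i <- t) x i p).
Proof.
apply: continuous_big => [q|t _ p]; first exact: add_continuous.
apply: cvgM; first exact: cvg_cst.
by apply: continuous_big => // q; exact: mul_continuous.
Qed.

End PolynomialContinuity.

Section Simplex.
Variables (R : realType) (V : finType).
Import ArrowAsProduct.
Local Open Scope classical_set_scope.

Let T := prod_topology (fun _ : V => R : topologicalType).

Let coord_continuous (i : V) : continuous (fun z : T => z i).
Proof. exact: (@proj_continuous V (fun=> R : topologicalType) i). Qed.

(** The quotient is maximized over the simplex rather than over the sphere of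
[power_mass]: rescaling onto the simplex needs no roots, and [power_mass] is
positive there. *)
Lemma ratio_max (m : nat) (a : m.-tuple V -> R) (i0 : V) :
  exists y : V -> R, [/\ forall j, 0 <= y j, 0 < \sum_j y j
    & forall z : V -> R, (forall j, 0 <= z j) -> \sum_j z j = 1 ->
      tensor_form a z / power_mass m z <= tensor_form a y / power_mass m y].
Proof.
pose total (z : T) : R := \sum_j z j.
have total_continuous : continuous total.
  exact (continuous_linear_form coord_continuous).
pose K : set T := [set z : T | forall j : V, `[0, 1] (z j)] `&`
  total @^-1` [set x : R | x = 1].
have K0 : K !=set0.
  exists (fun j => (j == i0)%:R); split => /= [j|].
    by rewrite in_itv /= ler0n lern1 leq_b1.
  by rewrite /total -natr_sum (bigD1 i0) //= eqxx big1 // => j /negPf->.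
have cK : compact K.
  apply: compact_closedI.
    apply: (@tychonoff V (fun=> R : topologicalType) (fun=> `[0, 1])) => j.
    exact: segment_compact.
  have closed1 : closed [set x : R | x = 1] by exact: closed_eq.
  exact ((continuous_closedP _).1 total_continuous _ closed1).
have Kge0 z : K z -> forall j, 0 <= z j.
  by case=> + _ j => /(_ j) /=; rewrite in_itv /= => /andP[].
have form_continuous : continuous (tensor_form a : T -> R).
  exact (continuous_tensor_form coord_continuous (a := a)).
have mass_continuous : continuous (power_mass m : T -> R).
  exact (continuous_power_sum coord_continuous (m := m)).
have ratio_continuous :
    {within K, continuous (fun z : T => tensor_form a z / power_mass m z)}.
  apply: continuous_in_subspaceT => z /set_mem Kz.
  have mz : power_mass m z != 0.
    rewrite gt_eqF // power_mass_gt0 //; first exact: Kge0.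
    by change (0 < total z); case: Kz => _ ->.
  apply: (cvgM (form_continuous z)); exact: (cvgV mz (mass_continuous z)).
have [y /set_mem Ky ymax] := compact_EVT_max K0 cK ratio_continuous.
exists y; split; [exact: Kge0|by change (0 < total y); case: Ky => _ -> |].
move=> z z0 z1; apply: ymax; apply/mem_set; split=> //= j.
by rewrite in_itv /= z0 /= -z1 (bigD1 j) //= lerDl sumr_ge0.
Qed.

End Simplex.

(** * Maximizers of the Rayleigh quotient are eigenvectors *)

(** Factor the difference of powers and bound each of its [n] terms. *)
Lemma subrXX_le (R : numDomainType) n (u v : R) : 0 <= v -> v <= u ->
  u ^+ n - v ^+ n <= n%:R * (u - v) * u ^+ n.-1.
Proof.
move=> v0 vu; have u0 := le_trans v0 vu.
rewrite subrXX [n%:R * _]mulrC -mulrA mulr_natl.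
apply: ler_wpM2l; first by rewrite subr_ge0.
apply: le_trans (_ : \sum_(i < n) u ^+ n.-1 <= _).
  apply: ler_sum => i _.
  have le_in : (i <= n.-1)%N by case: n i => [[]//|n] i; rewrite -ltnS.
  rewrite -[in leRHS](subnK le_in) exprD.
  by apply: ler_pM; rewrite ?exprn_ge0 //; exact: lerXn2r.
by rewrite sumr_const card_ord.
Qed.

Lemma le_mul_expr_right (R : realType) n (c M v : R) :
  (forall tau, 0 < tau -> c <= M * (v + tau) ^+ n) -> c <= M * v ^+ n.
Proof.
move=> c_le.
apply: (@cvgr_to_ge _ (at_right 0) _ R (fun tau => M * (v + tau) ^+ n)).
  apply: cvg_at_right_filter; apply: cvgM; first exact: cvg_cst.
  rewrite -[in X in cvg_to _ X](addr0 v).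
  apply: (@continuous_comp _ _ _ (fun tau : R => v + tau)
            (fun x : R => x ^+ n)).
    by apply: cvgD; [exact: cvg_cst|exact: cvg_id].
  exact: exprn_continuous.
near=> tau; apply: c_le; near: tau; exact: nbhs_right_gt.
Unshelve. all: by end_near. Qed.

Section TensorForm.
Variables (R : realType) (V : finType) (m : nat) (a : m.-tuple V -> R).
Implicit Types y z : V -> R.

Lemma tensor_formZ c z :
  tensor_form a (fun j => c * z j) = c ^+ m * tensor_form a z.
Proof.
rewrite /tensor_form mulr_sumr; apply: eq_bigr => t _.
rewrite big_split /= (big_tuple _ _ t xpredT (fun=> c)) prodr_const card_ord.
exact: mulrCA.
Qed.

Lemma power_massZ c z :
  power_mass m (fun j => c * z j) = c ^+ m * power_mass m z.
Proof.
by rewrite /power_mass mulr_sumr; apply: eq_bigr => j _; rewrite exprMn.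
Qed.

(** Euler's identity, obtained by sorting the index tuples by their head. *)
Lemma tensor_form_contract z :
  (0 < m)%N -> tensor_form a z = \sum_i z i * contract a z i.
Proof.
case: m a => // n b _; rewrite /tensor_form /contract.
transitivity (\sum_i \sum_(t : n.+1.-tuple V | ohead t == Some i)
                b t * \prod_(j <- t) z j).
  rewrite (partition_big (@thead n V) xpredT) //=.
  apply: eq_bigr => i _; apply: eq_bigl => t.
  by case/tupleP: t => x t; rewrite theadE /= inj_eq //; apply: Some_inj.
apply: eq_bigr => i _; rewrite mulr_sumr; apply: eq_bigr => t.
case/tupleP: t => x t /= /eqP[->]; rewrite big_cons.
by rewrite mulrCA.
Qed.

(** Symmetry enters here: the rotation that brings position [p] to the front
permutes the tuple, so fixing the index at any position gives the same sum as
fixing it at the head. *)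
Lemma contract_at_position z i (p : 'I_m) :
  (forall t u : m.-tuple V, perm_eq t u -> a t = a u) ->
  \sum_(t : m.-tuple V | tnth t p == i)
     a t * \prod_(j <- take p t ++ drop p.+1 t) z j = contract a z i.
Proof.
move=> a_sym; rewrite /contract.
have rK : cancel (fun t : m.-tuple V => [tuple of rotr p t])
                 (fun t : m.-tuple V => [tuple of rot p t]).
  by move=> t; apply: val_inj; rewrite /= rotrK.
have rK' : cancel (fun t : m.-tuple V => [tuple of rot p t])
                 (fun t : m.-tuple V => [tuple of rotr p t]).
  by move=> t; apply: val_inj; rewrite /= rotK.
rewrite [RHS](reindex (fun t : m.-tuple V => [tuple of rot p t])) /=; last first.
  by apply: onW_bij; exists (fun t : m.-tuple V => [tuple of rotr p t]).
have rot_cons (t : m.-tuple V) : rot p t = tnth t p :: (drop p.+1 t ++ take p t).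
  by rewrite /rot (drop_nth (tnth t p)) ?size_tuple // -tnth_nth.
apply: eq_big => [t|t _]; first by rewrite rot_cons /= inj_eq //; apply: Some_inj.
congr (_ * _); first by apply: a_sym; rewrite /= perm_sym perm_rot.
by rewrite rot_cons /= !big_cat /= mulrC.
Qed.

(** The right-hand side is a polynomial in [tau] with nonnegative coefficients;
the left-hand side is its truncation to degree one. *)
Lemma prod_shift_ge z i tau (s : seq V) :
  (forall j, 0 <= z j) -> 0 <= tau ->
  \prod_(j <- s) z j
    + tau * (\sum_(p < size s)
               (nth i s p == i)%:R * \prod_(j <- take p s ++ drop p.+1 s) z j)
  <= \prod_(j <- s) (z j + tau * (j == i)%:R).
Proof.
move=> z0 tau0; have prod0 u : 0 <= \prod_(j <- u) z j by apply: prodr_ge0.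
elim: s => [|x s IHs]; first by rewrite big_ord0 !big_nil mulr0 addr0.
rewrite big_ord_recl !big_cons.
under [X in tau * (_ + X)]eq_bigr do rewrite lift0 /= big_cons mulrCA.
rewrite /= drop0 -mulr_sumr; set D := \sum_(_ < _) _ in IHs *.
have D0 : 0 <= D by apply: sumr_ge0 => p _; rewrite mulr_ge0 ?ler0n.
apply: le_trans (ler_wpM2l _ IHs); last by rewrite addr_ge0 // mulr_ge0 ?ler0n.
have bD0 : 0 <= tau * (x == i)%:R * (tau * D) by rewrite !mulr_ge0 ?ler0n.
(* The difference of the two sides is exactly this quadratic term. *)
rewrite -subr_ge0; apply: le_trans bD0 _; rewrite le_eqVlt; apply/orP; left.
by apply/eqP; ring.
Qed.

Hypothesis a_ge0 : forall t, 0 <= a t.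
Hypothesis a_sym : forall t u : m.-tuple V, perm_eq t u -> a t = a u.

Lemma contract_ge0 z i : (forall j, 0 <= z j) -> 0 <= contract a z i.
Proof. by move=> z0; apply: sumr_ge0 => t _; rewrite mulr_ge0 ?prodr_ge0. Qed.

Lemma tensor_form_ge0 z : (forall j, 0 <= z j) -> 0 <= tensor_form a z.
Proof. by move=> z0; apply: sumr_ge0 => t _; rewrite mulr_ge0 ?prodr_ge0. Qed.

(** A lower bound by the tangent line suffices below, so no derivative has to
be taken. *)
Lemma tensor_form_shift_ge z i tau :
  (forall j, 0 <= z j) -> 0 <= tau ->
  tensor_form a z + tau * (m%:R * contract a z i)
    <= tensor_form a (fun j => z j + tau * (j == i)%:R).
Proof.
move=> z0 tau0.
have -> : m%:R * contract a z i = \sum_t a t * \sum_(p < m)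
     (tnth t p == i)%:R * \prod_(j <- take p t ++ drop p.+1 t) z j.
  under [RHS]eq_bigr do rewrite mulr_sumr.
  rewrite exchange_big /=.
  transitivity (\sum_(p < m) contract a z i).
    by rewrite sumr_const card_ord mulr_natl.
  apply: eq_bigr => p _; rewrite -(contract_at_position z i p a_sym) big_mkcond.
  by apply: eq_bigr => t _; case: ifP; rewrite ?mul1r // mul0r mulr0.
rewrite mulr_sumr -big_split; apply: ler_sum => t _ /=.
rewrite mulrCA -mulrDr; apply: ler_wpM2l => //.
apply: le_trans (prod_shift_ge i t z0 tau0); rewrite size_tuple lerD2l.
apply: ler_wpM2l => //; apply: ler_sum => p _.
by rewrite (tnth_nth i).
Qed.

(** Only increases of single coordinates are tested, which are admissible at the
boundary of the orthant as well.  They give one inequality for each coordinate,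
and Euler's identity says that the [y]-weighted sum of the gaps is zero.  The
condition [1 < m] is what makes the right-hand side vanish when [y i = 0]. *)
Lemma maximizer_is_eigenvector M y :
  (1 < m)%N -> (forall j, 0 <= y j) -> tensor_form a y = M * power_mass m y ->
  (forall z, (forall j, 0 <= z j) -> tensor_form a z <= M * power_mass m z) ->
  0 <= M ->
  forall i, contract a y i = M * y i ^+ m.-1.
Proof.
move=> m1 y0 Fy Fle M0; have m0 := ltnW m1.
have cle i : contract a y i <= M * y i ^+ m.-1.
  apply: le_mul_expr_right => tau tau0.
  have shift_ge0 j : 0 <= y j + tau * (j == i)%:R.
    by rewrite addr_ge0 // mulr_ge0 ?ler0n ?ltW.
  have := le_trans (tensor_form_shift_ge i y0 (ltW tau0)) (Fle _ shift_ge0).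
  rewrite Fy -lerBrDl -mulrBr /power_mass.
  rewrite (bigD1 i) //= [X in _ - X](bigD1 i) //= eqxx mulr1 opprD addrACA.
  under eq_bigr => j /negPf-> do rewrite mulr0 addr0.
  rewrite subrr addr0.
  have yi_le : y i <= y i + tau by rewrite lerDl ltW.
  have /(ler_wpM2l M0) := subrXX_le m (y0 i) yi_le.
  move=> /[swap] /le_trans /[apply].
  rewrite [y i + tau]addrC addrK addrC.
  have -> : M * (m%:R * tau * (y i + tau) ^+ m.-1)
    = tau * (m%:R * (M * (y i + tau) ^+ m.-1)) by ring.
  by rewrite !ler_pM2l ?ltr0n.
have gap0 : \sum_i y i * (M * y i ^+ m.-1 - contract a y i) = 0.
  under eq_bigr do rewrite mulrBr mulrCA -exprS prednK //.
  by rewrite sumrB -tensor_form_contract // Fy /power_mass mulr_sumr subrr.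
have gap_ge0 j : true -> 0 <= y j * (M * y j ^+ m.-1 - contract a y j).
  by rewrite mulr_ge0 // subr_ge0.
move=> i; have /eqP := psumr_eq0P gap_ge0 gap0 (i := i) isT.
rewrite mulf_eq0 subr_eq0 => /orP[/eqP yi0|/eqP-> //].
apply/le_anti; rewrite cle yi0 expr0n /= -subn1 subn_eq0 leqNgt m1 mulr0.
exact: contract_ge0.
Qed.

(** Homogeneity extends the maximum from the simplex to the whole orthant. *)
Lemma rayleigh_maximum (i0 : V) : (0 < m)%N ->
  exists M (y : V -> R), [/\ forall j, 0 <= y j, 0 < \sum_j y j,
     tensor_form a y = M * power_mass m y
    & forall z, (forall j, 0 <= z j) -> tensor_form a z <= M * power_mass m z].
Proof.
move=> m0; have [y [y0 ysum ymax]] := ratio_max a i0.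
have Ny := power_mass_gt0 m y0 ysum.
exists (tensor_form a y / power_mass m y), y; split => //.
  by rewrite divfK // gt_eqF.
move=> z z0; have [zsum|zsum] := eqVneq (\sum_j z j) 0.
  have zj j : z j = 0 by apply: (psumr_eq0P _ zsum (i := j) isT).
  rewrite [tensor_form a z]big1 => [|t _].
    apply: mulr_ge0; first by rewrite divr_ge0 ?tensor_form_ge0 // ltW.
    by apply: sumr_ge0 => j _; exact: exprn_ge0.
  case: (tval t) (size_tuple t) => [/= m_eq|x s _]; first by rewrite -m_eq in m0.
  by rewrite big_cons zj mul0r mulr0.
set c := \sum_j z j in zsum.
have c0 : 0 < c by rewrite lt_neqAle eq_sym zsum sumr_ge0.
have cm0 : c^-1 ^+ m != 0 by rewrite expf_neq0 // invr_eq0.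
have cz0 j : 0 <= c^-1 * z j by rewrite mulr_ge0 // invr_ge0 ltW.
have := ymax _ cz0; rewrite -mulr_sumr mulVf // => /(_ erefl).
rewrite tensor_formZ power_massZ -mulf_div divff // mul1r.
by rewrite ler_pdivrMr // power_mass_gt0.
Qed.

(** At an index [i] where [y] is largest, every product in [contract a y i] is
at most [y i ^+ m.-1]. *)
Lemma eigenvalue_le_row_sum M d y :
  (forall j, 0 <= y j) -> 0 < \sum_j y j ->
  (forall i, contract a y i = M * y i ^+ m.-1) ->
  (forall i, contract a (fun=> 1) i <= d) -> M <= d.
Proof.
move=> y0 ysum eig row_le.
have [i0 _] : exists i0 : V, true.
  apply/existsP; apply: contraLR ysum => /existsPn V0.
  by rewrite big1 ?ltxx // => j; have := V0 j.
have [i _ y_max] := arg_maxP y (erefl : xpredT i0).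
have yi0 : 0 < y i.
  rewrite lt_neqAle y0 andbT eq_sym; apply: contraTneq ysum => yi.
  rewrite big1 ?ltxx // => j _; apply/le_anti.
  by rewrite y0 andbT -yi; exact: y_max.
have yim0 : 0 < y i ^+ m.-1 by exact: exprn_gt0.
rewrite -(ler_pM2r yim0) -eig.
apply: le_trans (ler_wpM2r (ltW yim0) (row_le i)); rewrite mulr_suml.
apply: ler_sum => t _; rewrite [X in _ * X * _]big1 // mulr1 ler_wpM2l //.
apply: le_trans (_ : \prod_(j <- behead t) y i <= _).
  by apply: ler_prod => j _; rewrite y0; exact: y_max.
by rewrite (big_tuple _ _ [tuple of behead t] xpredT (fun=> y i)) prodr_const
  card_ord.
Qed.

End TensorForm.

(** * Complex eigenvalues of a nonnegative symmetric tensor *)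

Section SpectralRadius.
Local Open Scope complex_scope.
Variables (R : realType) (V : finType) (m : nat) (a : m.-tuple V -> R).

Let A : tensor R m V := fun t => (a t)%:C.

Lemma tensor_apply_real (y : V -> R) i :
  tensor_apply A [ffun j => (y j)%:C] i = (contract a y i)%:C.
Proof.
rewrite /tensor_apply /contract rmorph_sum /=; apply: eq_bigr => t _.
by rewrite rmorphM rmorph_prod; under eq_bigr do rewrite ffunE.
Qed.

(** Degenerate order one: the products over the tail are empty. *)
Lemma tensor_apply_order1 (x : {ffun V -> R[i]}) i :
  m.-1 = 0%N -> tensor_apply A x i = (contract a (fun=> 1) i)%:C.
Proof.
move=> m1; rewrite /tensor_apply /contract rmorph_sum; apply: eq_bigr => t _.
rewrite (size0nil (_ : size (behead t) = 0%N)) ?big_nil ?mulr1 //.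
by rewrite size_behead size_tuple.
Qed.

Lemma normc_Re (x : R[i]) : `|x| = (complex.Re `|x|)%:C.
Proof. by rewrite RRe_real ?normr_real. Qed.

Hypothesis a_ge0 : forall t, 0 <= a t.

(** Passing to moduli turns the eigenvalue equation into an inequality for a
nonnegative real vector, which can be compared with the Rayleigh quotient. *)
Lemma norm_eigenvalue_le M lambda : (0 < m)%N ->
  (forall z, (forall j, 0 <= z j) -> tensor_form a z <= M * power_mass m z) ->
  is_eigenvalue A lambda -> `|lambda| <= M%:C.
Proof.
move=> m0 formM [x x0 eig_x].
pose u j := complex.Re `|x j|; pose l := complex.Re `|lambda|.
have uE j : `|x j| = (u j)%:C := normc_Re (x j).
have u0 j : 0 <= u j by rewrite -lecR -uE normr_ge0.
have u_sum : 0 < \sum_j u j.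
  rewrite lt_neqAle sumr_ge0 // andbT eq_sym; apply: contraNneq x0.
  move=> /(psumr_eq0P (fun j _ => u0 j)) u_eq0; apply/eqP/ffunP => j.
  by apply/eqP; rewrite ffunE -normr_eq0 uE u_eq0.
have l_contract i : l * u i ^+ m.-1 <= contract a u i.
  rewrite -lecR rmorphM rmorphXn /= -uE -normc_Re -normrX -normrM -eig_x.
  rewrite rmorph_sum; apply: le_trans (ler_norm_sum _ _ _) _.
  apply: ler_sum => t _; rewrite normrM rmorphM rmorph_prod normr_prod /=.
  rewrite -[X in X * _]ger0_norm ?normr_ge0 // normr_id.
  by under eq_bigr do rewrite uE; rewrite ger0_norm // lecR.
rewrite (normc_Re lambda) lecR -/l -(ler_pM2r (power_mass_gt0 m u0 u_sum)).
apply: le_trans (formM _ u0); rewrite (tensor_form_contract a) //.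
rewrite /power_mass mulr_sumr; apply: ler_sum => i _.
by rewrite -[m in X in X <= _]prednK // exprS mulrCA ler_wpM2l.
Qed.

Hypothesis a_sym : forall t u : m.-tuple V, perm_eq t u -> a t = a u.

Theorem spectral_radius_rayleigh (i0 : V) : (1 < m)%N ->
  exists M (y : V -> R), [/\ is_spectral_radius A M,
    (forall j, 0 <= y j) /\ 0 < \sum_j y j,
    forall i, contract a y i = M * y i ^+ m.-1 &
    forall z, (forall j, 0 <= z j) -> tensor_form a z <= M * power_mass m z].
Proof.
move=> m1; have m0 := ltnW m1.
have [M [y [y0 ysum formy formM]]] := rayleigh_maximum a_ge0 i0 m0.
have M0 : 0 <= M.
  rewrite -(pmulr_lge0 _ (power_mass_gt0 m y0 ysum)) -formy.
  exact: tensor_form_ge0.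
have eig := maximizer_is_eigenvector a_ge0 a_sym m1 y0 formy formM M0.
exists M, y; split => //; split; last first.
  by move=> lambda; apply: norm_eigenvalue_le.
exists (M%:C); last by rewrite ger0_norm // lecR.
exists [ffun j => (y j)%:C] => [|i].
  apply: contraTneq ysum => /ffunP y_eq0; rewrite big1 ?ltxx // => j _.
  by have := y_eq0 j; rewrite !ffunE => -[].
by rewrite tensor_apply_real eig rmorphM rmorphXn ffunE.
Qed.

End SpectralRadius.

Lemma spectral_radius_unique (R : realType) (V : finType) (m : nat)
    (B : tensor R m V) (r s : R) :
  is_spectral_radius B r -> is_spectral_radius B s -> r = s.
Proof.
move=> [[l eig_l lE] r_max] [[l' eig_l' l'E] s_max].
apply/le_anti; rewrite -!lecR -{1}lE -{2}l'E s_max //.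
exact: r_max.
Qed.

(** * Counting the orderings of a padded edge *)

Section Multinomial.
Variable V : finType.
Implicit Types (s : seq V) (e : {set V}).
Local Open Scope nat_scope.

Lemma sum_count_mem s : \sum_(x in s) count_mem x s = size s.
Proof.
rewrite -sum1_size (eq_bigr (fun x => \sum_(y <- s | y == x) 1)); last first.
  by move=> x _; rewrite sum1_count.
rewrite (exchange_big_dep xpredT) //= big_seq [RHS]big_seq.
apply: eq_bigr => y ys; rewrite (big_pred1 y) // => x /=.
by rewrite eq_sym andbC; case: eqP => // ->.
Qed.

(** The multinomial coefficient.  Removing the first letter [x] of an ordering
leaves an ordering of [rem x s]; multiplied by the factorials of the
multiplicities of [s], the number of these is [count_mem x s * (size s).-1`!],
and the multiplicities add up to the size. *)
Lemma size_permutations_multinomial s :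
  size (permutations s) * \prod_(x : V) (count_mem x s)`! = (size s)`!.
Proof.
move: {2}(size s) (erefl (size s)) => n; elim: n s => [|n IHn] s s_n.
  by rewrite (size0nil s_n) /= big1.
rewrite (perm_size (permutationsE _)) ?s_n // size_allpairs_dep sumnE big_map.
rewrite (big_uniq _ (undup_uniq s)) /= (eq_bigl _ _ (mem_undup s)) big_distrl /=.
transitivity (\sum_(x in s) count_mem x s * n`!); last first.
  by rewrite -big_distrl /= sum_count_mem s_n factS.
apply: eq_bigr => x xs.
have rem_n : size (rem x s) = n by rewrite size_rem // s_n.
have count_x : count_mem x s = (count_mem x (rem x s)).+1.
  by rewrite count_rem xs /= eqxx subn1 prednK // -has_count has_pred1.
rewrite -[in RHS]rem_n -(IHn _ rem_n) [RHS]mulnCA; congr (_ * _).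
rewrite (bigD1 x) //= [in RHS](bigD1 x) //= count_x factS -!mulnA.
congr (_ * (_ * _)); apply: eq_bigr => y /negPf yx.
by rewrite count_rem xs /= eq_sym yx subn0.
Qed.

Lemma card_tuple_perm_eq m s : size s = m ->
  #|[set t : m.-tuple V | perm_eq t s]| = size (permutations s).
Proof.
move=> s_m; rewrite cardE -(size_map val); apply: perm_size; apply: uniq_perm.
- by rewrite map_inj_uniq ?enum_uniq //; exact: val_inj.
- exact: permutations_uniq.
move=> u; rewrite mem_permutations; apply/mapP/idP => [[t + ->]|us].
  by rewrite mem_enum inE.
have u_m : size u == m by rewrite (perm_size us) s_m.
by exists (Tuple u_m); rewrite // mem_enum inE.
Qed.

(** The multiset of size [m] supported on [e] in which [j] takes up all the
repetitions. *)
Definition padded_edge m e j : seq V := nseq (m - #|e|) j ++ enum e.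

Lemma size_padded_edge m e j : #|e| <= m -> size (padded_edge m e j) = m.
Proof. by move=> em; rewrite size_cat size_nseq -cardE subnK. Qed.

Lemma count_padded_edge m e j x :
  count_mem x (padded_edge m e j) = (j == x) * (m - #|e|) + (x \in e).
Proof.
by rewrite count_cat count_nseq (count_uniq_mem _ (enum_uniq _)) mem_enum.
Qed.

Lemma mem_padded_edge m e j : j \in e -> padded_edge m e j =i e.
Proof.
move=> je x; rewrite mem_cat mem_enum mem_nseq.
by case: eqP => [->|_]; rewrite ?andbF // je orbT.
Qed.

Lemma card_padded_edge m e j : j \in e -> #|e| <= m ->
  #|[set t : m.-tuple V | perm_eq t (padded_edge m e j)]| * (m - #|e|).+1`!
    = m`!.
Proof.
move=> je em; have size_s := size_padded_edge j em.
rewrite card_tuple_perm_eq // -[in RHS]size_s -size_permutations_multinomial.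
congr (_ * _); rewrite (bigD1 j) //= count_padded_edge eqxx je mul1n addn1.
rewrite big1 ?muln1 // => x /negPf xj.
by rewrite count_padded_edge eq_sym xj; case: (x \in e).
Qed.

(** Each of the [#|e|] multisets contains [x] once, and the one padded with [x]
contains [m - #|e|] further copies. *)
Lemma sum_count_padded_edge m e x : x \in e -> #|e| <= m ->
  \sum_(j in e) count_mem x (padded_edge m e j) = m.
Proof.
move=> xe em; rewrite (eq_bigr _ (fun j _ => count_padded_edge m e j x)).
rewrite big_split /= sum_nat_const xe muln1 (bigD1 x) //= eqxx mul1n big1 ?addn0.
  by rewrite subnK.
by move=> j /andP[_ /negPf->].
Qed.

End Multinomial.

(** * The adjacency tensor *)

Lemma invf_fact_pred (F : numFieldType) n : (0 < n)%N ->
  n`!%:R^-1 *+ n = (n.-1)`!%:R^-1 :> F.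
Proof.
case: n => // n _; rewrite factS natrM invfM -[LHS]mulr_natl mulrA.
by rewrite divff ?mul1r // pnatr_eq0.
Qed.

Section Adjacency.
Variables (R : realType) (V : finType) (H : hypergraph V).
Local Notation k := (rank H).
Implicit Types (e : {set V}) (i j : V).

Definition edge_weight (e : {set V}) : R := (k - #|e|).+1`!%:R / k`!%:R.

(** One formula for edges of all sizes.  For [#|e| < k] at most one [j]
contributes; for [#|e| = k] nothing is padded, all [k] choices of [j] contribute
the same [1 / k!], and the sum is the entry [1 / (k - 1)!].  Symmetry and
nonnegativity are visible in this form. *)
Definition real_adjacency (t : k.-tuple V) : R :=
  \sum_(e in edges H) \sum_(j in e)
    (perm_eq t (padded_edge k e j))%:R * edge_weight e.

Lemma card_edge_le e : e \in edges H -> (#|e| <= k)%N.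
Proof. by move=> eH; rewrite /rank (bigD1 e) //= leq_maxl. Qed.

Lemma perm_padded_edge_set (t : seq V) e j : j \in e ->
  perm_eq t (padded_edge k e j) -> [set x in t] = e.
Proof.
by move=> je /perm_mem tE; apply/setP=> x; rewrite inE tE mem_padded_edge.
Qed.

(** When [#|e| < k], the padding vertex is the only one of multiplicity at
least two. *)
Lemma perm_padded_edge_inj (t : seq V) e i j : (#|e| < k)%N ->
  i \in e -> perm_eq t (padded_edge k e i) -> perm_eq t (padded_edge k e j) ->
  i = j.
Proof.
move=> ek ie ti tj; have := seq.permP (perm_trans (etrans (perm_sym _ _) ti) tj).
move=> /(_ (pred1 i)); rewrite !count_padded_edge eqxx ie => /addIn/eqP.
by case: (j =P i) => [-> //|_]; rewrite mul1n mul0n subn_eq0 leqNgt ek.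
Qed.

Lemma perm_padded_edgeE (t : seq V) j : size t = k ->
  let e := [set x in t] in j \in e -> (#|e| <= k)%N ->
  perm_eq t (padded_edge k e j) =
  (count_mem j t == (k - #|e|).+1) && [forall x in e :\ j, count_mem x t == 1%N].
Proof.
move=> t_k e je ek; apply/idP/andP => [/seq.permP tE|[/eqP tj /forall_inP te]].
  split; first by rewrite tE count_padded_edge eqxx je mul1n addn1.
  apply/forall_inP => x; rewrite !inE => /andP[/negPf xj xt].
  by rewrite tE count_padded_edge [j == x]eq_sym xj mul0n inE xt.
apply/allP => x _ /=; rewrite count_padded_edge; have [<-|jx] := eqVneq j x.
  by rewrite tj je mul1n addn1.
rewrite mul0n add0n; have [xe|] := boolP (x \in e).
  by rewrite (eqP (te x _)) // in_setD1 eq_sym jx.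
by rewrite inE => /count_memPn->.
Qed.

Lemma adjacency_tensorE t : adjacency_tensor R H t = (real_adjacency t)%:C%C.
Proof.
rewrite /adjacency_tensor /real_adjacency; set e := [set x in t].
have t_k : size t = k := size_tuple t.
case: ifPn => [eH|/negPn eH].
  rewrite !big1 ?rmorph0 // => e' e'H; apply: big1 => j je'.
  case: (boolP (perm_eq _ _)) => [/(perm_padded_edge_set je') tE|]; last first.
    by rewrite mul0r.
  by rewrite /e tE e'H in eH.
have ek := card_edge_le eH.
rewrite (bigD1 e) //= [X in _ + X]big1 ?addr0 => [|e' /andP[e'H e'e]]; last first.
  apply: big1 => j je'; case: (boolP (perm_eq _ _)); last by rewrite mul0r.
  by move=> /(perm_padded_edge_set je') tE; rewrite /e tE eqxx in e'e.
have [e_k|e_k] := eqVneq #|e| k.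
  have ut : perm_eq t (enum e).
    apply: uniq_perm (enum_uniq _) _ => [|x]; last by rewrite mem_enum inE.
    by apply/card_uniqP; rewrite t_k -[RHS]e_k; apply: eq_card => x; rewrite inE.
  rewrite (eq_bigr (fun=> k`!%:R^-1)) => [|j _]; last first.
    by rewrite /padded_edge /edge_weight e_k subnn /= ut mul1r mul1r.
  have -> : \sum_(j in e) k`!%:R^-1 = (k.-1)`!%:R^-1 :> R.
    by rewrite sumr_const -invf_fact_pred ?rank_gt0 // [#|_|]e_k.
  by rewrite fmorphV rmorph_nat.
have {}e_k : (#|e| < k)%N by rewrite ltn_neqAle e_k.
case: existsP => [[j /andP[je]]|noj].
  rewrite -perm_padded_edgeE // => tj.
  rewrite (bigD1 j) //= tj big1 ?addr0 ?mul1r.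
    by rewrite /edge_weight rmorphM fmorphV !rmorph_nat.
  move=> i /andP[ie /negP ij]; case: (boolP (perm_eq _ _)); last by rewrite mul0r.
  by move=> /(perm_padded_edge_inj e_k je tj) ji; case: ij; rewrite ji.
rewrite big1 ?rmorph0 // => j je; case: (boolP (perm_eq _ _)); last by rewrite mul0r.
by move=> tj; case: noj; exists j; rewrite je -perm_padded_edgeE.
Qed.

Lemma real_adjacency_ge0 t : 0 <= real_adjacency t.
Proof.
by do 2![apply: sumr_ge0 => ? _]; rewrite mulr_ge0 ?divr_ge0 ?ler0n.
Qed.

Lemma real_adjacency_sym (t u : k.-tuple V) :
  perm_eq t u -> real_adjacency t = real_adjacency u.
Proof.
move=> tu; apply: eq_bigr => e _; apply: eq_bigr => j _.
by rewrite (seq.permPl tu).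
Qed.

(** By symmetry, [k] times the row sum is the sum of all entries, each weighted
by the number of occurrences of [i].  The orderings of a padded edge cancel its
weight, so an edge [e] contributes the total multiplicity of [i] in its padded
multisets, which is [k] if [i] lies in [e] and zero otherwise. *)
Lemma row_sum_degree i : contract real_adjacency (fun=> 1) i = (degree H i)%:R.
Proof.
have k0 := rank_gt0 H; have kR0 : k%:R != 0 :> R by rewrite pnatr_eq0 -lt0n.
apply: (mulfI kR0).
transitivity (\sum_(p < k) contract real_adjacency (fun=> 1) i).
  by rewrite sumr_const card_ord mulr_natl.
transitivity (\sum_(t : k.-tuple V) (count_mem i t)%:R * real_adjacency t).
  rewrite (eq_bigr _ (fun p _ =>
    esym (contract_at_position (fun=> 1) i p real_adjacency_sym))).
  under eq_bigr do rewrite big_mkcond.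
  rewrite exchange_big; apply: eq_bigr => t _ /=.
  rewrite -big_mkcond /= -[count_mem i t]sum1_count natr_sum mulr_suml.
  rewrite (big_tuple _ _ t (pred1 i)); apply: eq_bigr => p _.
  by rewrite big1 // mulr1 mul1r.
transitivity (\sum_(e in edges H | i \in e) k%:R : R); last first.
  rewrite sumr_const mulr_natr; congr (_ *+ _).
  by rewrite /degree; apply: eq_card => e; rewrite !inE.
under eq_bigr do rewrite mulr_sumr.
rewrite exchange_big big_mkcondr; apply: eq_bigr => e eH /=.
under eq_bigr do rewrite mulr_sumr.
rewrite exchange_big /=.
have ek := card_edge_le eH.
transitivity (\sum_(j in e) (count_mem i (padded_edge k e j))%:R : R).
  apply: eq_bigr => j je.
  rewrite (eq_bigr (fun t : k.-tuple V => (perm_eq t (padded_edge k e j))%:R *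
     ((count_mem i (padded_edge k e j))%:R * edge_weight e))); last first.
    move=> t _; case: (boolP (perm_eq _ _)) => [/seq.permP->|_].
      by rewrite !mul1r.
    by rewrite !mul0r mulr0.
  rewrite -mulr_suml mulrCA -[RHS]mulr1; congr (_ * _).
  rewrite -natr_sum -big_mkcond /= sum1_card -cardsE mulrA -natrM.
  rewrite card_padded_edge //.
  by rewrite divff // pnatr_eq0 -lt0n fact_gt0.
case: ifPn => ie; first by rewrite -natr_sum sum_count_padded_edge.
apply: big1 => j je; suff -> : count_mem i (padded_edge k e j) = 0%N by [].
by apply/count_memPn; rewrite mem_padded_edge.
Qed.

End Adjacency.

(** * Spectral radius and average degree *)

Theorem theorem3p3 (R : realType) (V : finType) (H : hypergraph V) :
  ((1 < rank H)%N ->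
     exists rho : R, is_spectral_radius (adjacency_tensor R H) rho) /\
  (forall rho : R, is_spectral_radius (adjacency_tensor R H) rho ->
     avg_degree H R <= rho /\ (rho = avg_degree H R <-> regular H)).
Proof.
pose a := @real_adjacency R V H.
have -> : adjacency_tensor R H = (fun t => (a t)%:C%C).
  by apply: funext => t; exact: adjacency_tensorE.
have a_ge0 := @real_adjacency_ge0 R V H.
have a_sym := @real_adjacency_sym R V H.
have k0 := rank_gt0 H.
have [e eH] := set0Pn _ (has_edge H).
have [i0 _] : exists i0, i0 \in e.
  by apply/set0Pn; apply: contraNneq (edges_nonempty H) => <-.
have n0 : 0 < #|V|%:R :> R by rewrite ltr0n; apply/card_gt0P; exists i0.
have avg_const d : (forall i, (degree H i)%:R = d) -> avg_degree H R = d.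
  move=> deg; rewrite /avg_degree (eq_bigr _ (fun i _ => deg i)) sumr_const.
  by rewrite -[d *+ _]mulr_natr mulfK // gt_eqF.
have [k_gt1|k_le1] := ltnP 1 (rank H); last first.
  have p0 : (rank H).-1 = 0%N by case: (rank H) k_le1 => [|[|]].
  split=> // rho [[lambda [x _ eig] lambdaE] _].
  have degE i : (degree H i)%:R = lambda.
    have := eig i; rewrite tensor_apply_order1 // p0 expr0 mulr1 => <-.
    by rewrite row_sum_degree rmorph_nat.
  have reg : regular H.
    by move=> i j; apply/eqP; rewrite -(eqr_nat R[i]) !degE.
  have rhoE : rho = (degree H i0)%:R.
    by apply: complexI; rewrite rmorph_nat -lambdaE -(degE i0) normr_nat.
  have avgE : avg_degree H R = rho.
    by apply: avg_const => i; rewrite rhoE (reg i i0).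
  by rewrite avgE.
have [M [y [radM [y0 ysum] eig formM]]] :=
  spectral_radius_rayleigh a_ge0 a_sym i0 k_gt1.
split; first by exists M.
move=> rho /spectral_radius_unique/(_ radM) ->.
have mass1 : power_mass (rank H) (fun _ : V => 1) = #|V|%:R :> R.
  by rewrite /power_mass; under eq_bigr do rewrite expr1n; rewrite sumr_const.
have form1 : tensor_form a (fun=> 1) = avg_degree H R * #|V|%:R.
  rewrite tensor_form_contract // divfK ?gt_eqF //.
  by apply: eq_bigr => i _; rewrite mul1r row_sum_degree.
have avg_le : avg_degree H R <= M.
  by rewrite -(ler_pM2r n0) -form1 -mass1 formM.
split=> //; split=> [M_avg|reg].
  have M0 : 0 <= M by rewrite M_avg divr_ge0 ?ler0n ?sumr_ge0.
  have one_eig i : contract a (fun=> 1) i = M.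
    rewrite (maximizer_is_eigenvector a_ge0 a_sym k_gt1 _ _ formM) //.
    - by rewrite expr1n mulr1.
    - by rewrite form1 mass1 M_avg.
  move=> i j; apply/eqP; rewrite -(eqr_nat R) -!row_sum_degree.
  by rewrite !one_eig.
apply/le_anti; rewrite avg_le andbT.
rewrite (avg_const (degree H i0)%:R) => [|j]; last by rewrite (reg j i0).
apply: (eigenvalue_le_row_sum a_ge0 y0 ysum eig) => i.
by rewrite row_sum_degree (reg i i0).
Qed.
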